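(* Let $d\ge 2$ and $n,k\ge 0$ be integers. Then $N_d(n,k)$ equals the number of lattice paths in $\mathcal{F}_d$ consisting of $n$ steps in total, exactly $k$ of which are $(0,1)$ steps.
   Context: $N_d(n,k) = \frac{1}{n+1} \binom{n+1}{k+1} \binom{ n + (n-k)(d-2)+1}{k}$. $\mathcal{F}_d$ is the set of (possibly empty) labelled lattice paths such that: the path starts at $(0,0)$ and always stays on or above the line $y=x$; every step has the form $(\ell,1)$ for some integer $\ell\ge 0$; and every step $(\ell,1)$ with $\ell\ge 1$ is labelled by a composition of $\ell-1$ into $d-1$ nonnegative parts (an ordered list of $d-1$ nonnegative integers summing to $\ell-1$). Equivalently, a path with steps $(\ell_1,1),\dots,(\ell_n,1)$ lies in $\mathcal{F}_d$ (up to labels) iff $\ell_i\ge 0$ and $\sum_{j\le i}\ell_j\le i$ for all $i$. Two labelled paths are the same iff they have the same steps and the same labels. *)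

(* Defs.v *)
From mathcomp Require Import all_boot all_order all_algebra.

Set Implicit Arguments.
Unset Strict Implicit.
Unset Printing Implicit Defensive.

Import GRing.Theory.

(* The subtraction n - k is truncated, which is harmless: for k > n the first
   binomial coefficient vanishes. *)
Definition Nd (d n k : nat) : rat :=
  ((n.+1)%:R^-1 * 'C(n.+1, k.+1)%:R
     * 'C(n + (n - k) * (d - 2) + 1, k)%:R)%R.

Definition is_composition (m parts : nat) (c : seq nat) : bool :=
  (size c == parts) && (sumn c == m).

(* (l, lab) stands for the step (l, 1) carrying the label lab;
   None means that the step is unlabelled. *)
Definition lstep := (nat * option (seq nat))%type.
Definition lpath := seq lstep.

Definition displacement (s : lstep) : nat * nat := (s.1, 1).

Definition well_labelled (d : nat) (s : lstep) : bool :=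
  match s with
  | (0, None) => true
  | (l.+1, Some c) => is_composition l (d - 1) c
  | _ => false
  end.

Definition translate (v w : nat * nat) : nat * nat := (v.1 + w.1, v.2 + w.2).

Definition vertices (p : lpath) : seq (nat * nat) :=
  (0, 0) :: scanl translate (0, 0) (map displacement p).

(* By convexity a path stays in the half-plane x <= y as soon as its vertices
   do. *)
Definition in_F (d : nat) (p : lpath) : bool :=
  all (well_labelled d) p && all (fun v => v.1 <= v.2) (vertices p).

Definition num_up_steps (p : lpath) : nat :=
  count (fun s => displacement s == (0, 1)) p.

(* The predicate P has exactly m elements; its carrier T may be infinite. *)
Definition has_card (T : eqType) (P : pred T) (m : nat) : Prop :=
  exists s : seq T, [/\ uniq s, s =i P & size s = m].

(* Main.v *)
Require Import Defs.
From mathcomp Require Import all_boot all_order all_algebra.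
From mathcomp Require Import zify.

(** A (0,1) step put in front of a path turns the condition "on or above the
    diagonal" into "strictly above it".  By the ballot theorem, words of n+1
    steps of total horizontal displacement t that stay strictly above the
    diagonal make up a fraction (n+1-t)/(n+1) of all words, even when weighted
    by a permutation-invariant statistic such as the number of (0,1) steps.
    Hence (n+1) times the number of paths is the sum of n+1-t over all words
    with k+1 steps (0,1).  Choosing their positions gives 'C(n+1, k+1); what
    remains, weighted by n+1-t, counts the compositions of k into
    (n-k)(d-1) + 2 parts. *)

(** * Words over a finite alphabet and their weights *)

Section Words.

Variable T : eqType.
Implicit Types (X p q : seq T) (F : seq T -> nat).

Fixpoint words n X : seq (seq T) :=
  if n is m.+1 then [seq s :: p | s <- X, p <- words m X] else [:: [::]].

Lemma mem_words n X p : (p \in words n X) = (size p == n) && all (mem X) p.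
Proof.
elim: n p => [|n IH] [|s p] //=.
- by apply/allpairsP => -[[s' p'] []].
- apply/allpairsP/idP => [[[s' p'] /= [Hs Hp [-> ->]]]|].
    by rewrite eqSS; move: Hp; rewrite IH => /andP[-> ->]; rewrite Hs.
  rewrite eqSS => /and3P[Hsz Hs Hp].
  by exists (s, p); split; rewrite //= IH Hsz.
Qed.

Lemma words_uniq n X : uniq X -> uniq (words n X).
Proof.
move=> UX; elim: n => //= n IH.
by apply: allpairs_uniq => // -[s p] [s' p'] _ _ /= [-> ->].
Qed.

Lemma sum_words0 X F : \sum_(q <- words 0 X) F q = F [::].
Proof. by rewrite big_seq1. Qed.

Lemma sum_wordsS n X F :
  \sum_(q <- words n.+1 X) F q = \sum_(s <- X) \sum_(p <- words n X) F (s :: p).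
Proof. by rewrite /= big_allpairs_dep. Qed.

Arguments words : simpl never.

Lemma sum_wordsSr n X F :
  \sum_(q <- words n.+1 X) F q
    = \sum_(p <- words n X) \sum_(s <- X) F (rcons p s).
Proof.
elim: n F => [|n IH] F.
  by rewrite sum_wordsS sum_words0; apply: eq_bigr => s _; rewrite sum_words0.
rewrite sum_wordsS [RHS]sum_wordsS; apply: eq_bigr => s _.
exact: (IH (fun p => F (s :: p))).
Qed.

Variable wt : T -> nat.

Definition weight p := sumn (map wt p).

Lemma weight_rcons p s : weight (rcons p s) = weight p + wt s.
Proof. by rewrite /weight map_rcons sumn_rcons. Qed.

Lemma perm_weight p q : perm_eq p q -> weight p = weight q.
Proof. by move=> E; apply/perm_sumn/perm_map. Qed.

Definition symmetric_weight F := forall p q, perm_eq p q -> F p = F q.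

(* Exchangeability: each letter carries the same share of the total weight. *)
Lemma sum_words_last_weight n X F : symmetric_weight F ->
  n.+1 * (\sum_(p <- words n X) \sum_(s <- X) wt s * F (rcons p s))
    = \sum_(q <- words n.+1 X) weight q * F q.
Proof.
elim: n F => [|n IH] F symF.
  rewrite mul1n sum_words0 sum_wordsS; apply: eq_bigr => s _.
  by rewrite sum_words0 /weight /= addn0.
have symFs s : symmetric_weight (fun p => F (s :: p)).
  by move=> p q E; apply: symF; rewrite perm_cons.
have E s : \sum_(p <- words n.+1 X) weight (s :: p) * F (s :: p)
   = wt s * (\sum_(p <- words n.+1 X) F (s :: p))
     + n.+1 * (\sum_(p <- words n X) \sum_(t <- X) wt t * F (s :: rcons p t)).
  rewrite (IH _ (symFs s)) big_distrr -big_split /=.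
  by apply: eq_bigr => p _; rewrite /weight /= mulnDl.
rewrite [RHS]sum_wordsS (eq_bigr _ (fun s _ => E s)) big_split /= mulSn.
congr (_ + _).
  (* Moving the first letter to the end leaves [F] unchanged. *)
  rewrite exchange_big; apply: eq_bigr => s _; rewrite big_distrr.
  by apply: eq_bigr => p _; congr (_ * _); apply: symF; rewrite perm_rcons.
by rewrite -big_distrr /=; congr (_ * _); rewrite sum_wordsS.
Qed.

(** * The ballot theorem for symmetric weights *)

Definition ballot p := all (fun i => weight (take i p) < i) (iota 1 (size p)).

Lemma ballot_rcons p s :
  ballot (rcons p s) = ballot p && (weight (rcons p s) <= size p).
Proof.
rewrite /ballot size_rcons -(addn1 (size p)) iotaD all_cat /= andbT add1n.
rewrite take_oversize ?size_rcons // ltnS; congr (_ && _).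
apply: eq_in_all => i; rewrite mem_iota => /andP[_ Hi].
by rewrite -cats1 takel_cat //; lia.
Qed.

Lemma ballot_cons s p :
  ballot (s :: p)
    = all (fun i => wt s + weight (take i p) <= i) (iota 0 (size p).+1).
Proof. by rewrite /ballot -[1]addn0 iotaDl all_map. Qed.

(* A symmetric weight may contain the condition that the whole word ends below
   its length, so the induction hypothesis applies to a word without its last
   letter; the weight of that letter is then averaged out by exchangeability. *)
Lemma ballot_theorem n X F : symmetric_weight F ->
  n * (\sum_(q <- words n X) ballot q * F q)
    = \sum_(q <- words n X) (n - weight q) * F q.
Proof.
elim: n F => [|n IH] F symF; first by rewrite mul0n big1.
pose G q := (weight q <= n) * F q.
have symG : symmetric_weight G.
  by move=> p q E; rewrite /G (symF _ _ E) (perm_weight _ _ E).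
(* Length one is separate: the general step cancels the length of the shortened word, which must be
   positive. *)
case: n => [|n] in IH G symG *.
  rewrite mul1n; apply: eq_big_seq => -[|s [|t p]].
  - by rewrite mem_words.
  - by rewrite /ballot /weight /= addn0 andbT; case: (wt s) => [|[]].
  - by rewrite mem_words.
have symGs s : symmetric_weight (fun p => G (rcons p s)).
  move=> p q E; apply: symG.
  by rewrite perm_rcons perm_sym perm_rcons perm_sym perm_cons.
apply/eqP; rewrite -(eqn_pmul2l (ltn0Sn n)); apply/eqP.
have EB : \sum_(q <- words n.+2 X) ballot q * F q
   = \sum_(s <- X) \sum_(p <- words n.+1 X) ballot p * G (rcons p s).
  rewrite sum_wordsSr exchange_big; apply: eq_bigr => s _.
  apply: eq_big_seq => p; rewrite mem_words => /andP[/eqP Hp _].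
  by rewrite ballot_rcons Hp /G mulnA mulnb.
have EW : n.+1 * \sum_(q <- words n.+2 X) ballot q * F q
   = \sum_(q <- words n.+2 X) (n.+1 - weight q) * G q
     + \sum_(p <- words n.+1 X) \sum_(s <- X) wt s * G (rcons p s).
  rewrite EB big_distrr /=.
  under eq_bigr => s _ do rewrite (IH _ (symGs s)).
  rewrite sum_wordsSr [in RHS]exchange_big [X in _ = _ + X]exchange_big.
  rewrite -big_split /=; apply: eq_bigr => s _; rewrite -big_split /=.
  apply: eq_bigr => p _; rewrite -mulnDl /G weight_rcons.
  (* The truncated subtraction is exact wherever [G] is nonzero. *)
  by case: leqP => H; rewrite ?mul1n ?mul0n ?muln0 //; congr (_ * _); lia.
rewrite mulnCA EW mulnDr sum_words_last_weight // !big_distrr -big_split /=.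
apply: eq_bigr => q _; rewrite !mulnA -mulnDl /G.
(* For w <= n+1, (n+2)(n+1-w) + w = (n+1)(n+2-w); for larger w both sides vanish. *)
case: leqP => H; last by rewrite (_ : n.+2 - weight q = 0) ?muln0 //; lia.
by rewrite !muln1; congr (_ * _); nia.
Qed.

End Words.

Arguments words {T} n X : simpl never.
Arguments weight {T} wt p.
Arguments ballot {T} wt p.

(** * Binomial sums over compositions *)

(* The upper bound on the indices is irrelevant, as the terms with [M < i] vanish. *)
Lemma sum_bin_sub L M r : M <= L ->
  \sum_(i <- iota 0 L.+1) 'C(M - i, r.+1) = 'C(M.+1, r.+2).
Proof.
elim: L M => [|L IH] M HM.
  by rewrite big_seq1 subn0; case: M HM => // _; rewrite !bin_small.
rewrite (_ : iota 0 L.+2 = 0 :: map succn (iota 0 L.+1)); last first.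
  by rewrite /= -(iotaDl 1).
rewrite big_cons big_map subn0.
case: M HM => [|M] HM.
  by rewrite big1 // => i _; rewrite sub0n.
by rewrite [RHS]binS addnC -(IH M HM).
Qed.

(* Both sides vanish when [M < t]; this is where [r.+1 > 0] is needed. *)
Lemma bin_subnD M t r a b : a <= b ->
  'C(M - t + a, r.+1 + b) = 'C(M + a - t, r.+1 + b).
Proof.
move=> Hab; case: (leqP t M) => H; first by congr 'C(_, _); lia.
by rewrite !bin_small //; lia.
Qed.

(** Iterated hockey-stick identity: each part raises both indices by one. *)
Lemma sum_words_bin_sub p L M r : M + p <= L.+1 ->
  \sum_(c <- words p (iota 0 L.+1)) 'C(M - sumn c, r.+1) = 'C(M + p, r.+1 + p).
Proof.
elim: p M => [|p IH] M HM; first by rewrite sum_words0 /= subn0 !addn0.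
rewrite sum_wordsS.
under eq_bigr => i _.
  under eq_bigr => c _ do rewrite /= subnDA.
  rewrite IH; last by lia.
  rewrite bin_subnD // addSn.
  over.
by rewrite sum_bin_sub ?addnS //; lia.
Qed.

(** * The alphabet of labelled steps *)

Definition up_step : lstep := (0, None).

(** Here [e] is d-2. Capping the label entries rather than the step length makes the alphabet finite
    and lets the sum over labels run over each part independently. *)
Definition long_steps e L : seq lstep :=
  [seq ((sumn c).+1, Some c) | c <- words e.+1 (iota 0 L.+1)].

Definition steps e L : seq lstep := up_step :: long_steps e L.

Lemma steps_uniq e L : uniq (steps e L).
Proof.
rewrite /= map_inj_uniq ?words_uniq ?iota_uniq //; last by move=> c c' [].
by rewrite andbT; apply/mapP => -[].
Qed.

Lemma mem_steps e L s :
  well_labelled e.+2 s -> s.1 <= L -> s \in steps e L.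
Proof.
case: s => -[|l] [c|] //= /andP[/eqP Hc /eqP <-] Hl.
rewrite inE /=; apply: map_f; rewrite mem_words Hc eqxx andTb.
apply/allP => i Hi; rewrite inE mem_iota add0n ltnS.
apply: leq_trans Hl; apply: leqW.
elim: c Hi {Hc} => //= j c IH; rewrite inE => /orP[/eqP->|/IH]; lia.
Qed.

Lemma well_labelled_steps e L s : s \in steps e L -> well_labelled e.+2 s.
Proof.
rewrite inE => /orP[/eqP-> //|/mapP[c]].
by rewrite mem_words => /andP[/eqP Hc _] -> /=; rewrite /is_composition Hc !eqxx.
Qed.

(** A step is one longer than the sum of its [e.+1] parts, so the upper index rises by [e] only. *)
Lemma sum_long_steps e L M r : M + e <= L ->
  \sum_(s <- long_steps e L) 'C(M - s.1, r.+1) = 'C(M + e, r.+1 + e.+1).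
Proof.
move=> HM; rewrite big_map /=.
case: M HM => [|M] HM.
  by rewrite big1 => [|c _ //]; rewrite bin_small //; lia.
rewrite (eq_bigr (fun c => 'C(M - sumn c, r.+1))) //.
by rewrite sum_words_bin_sub ?addSnnS //; lia.
Qed.

Lemma num_up_steps_cons s p :
  num_up_steps (s :: p) = (s.1 == 0) + num_up_steps p.
Proof. by rewrite /num_up_steps /= /displacement xpair_eqE eqxx andbT. Qed.

(** Induction on the first letter: the up steps are placed in ['C(N, k)] ways by Pascal's rule, and
    each of the N-k long steps acts as in [sum_long_steps]. *)
Lemma sum_words_steps e L N k M r : M + N * e <= L ->
  \sum_(q <- words N (steps e L))
      (num_up_steps q == k) * 'C(M - weight fst q, r.+1)
    = 'C(N, k) * 'C(M + (N - k) * e, r.+1 + (N - k) * e.+1).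
Proof.
elim: N k M r => [|N IH] k M r HM.
  rewrite sum_words0 /weight /= subn0 !sub0n !mul0n !addn0.
  by case: k.
rewrite sum_wordsS big_cons.
have -> : \sum_(s <- long_steps e L) \sum_(p <- words N (steps e L))
       (num_up_steps (s :: p) == k) * 'C(M - weight fst (s :: p), r.+1)
    = 'C(N, k) * 'C(M + (N.+1 - k) * e, r.+1 + (N.+1 - k) * e.+1).
  transitivity (\sum_(s <- long_steps e L)
      'C(N, k) * 'C(M + (N - k) * e - s.1, r.+1 + (N - k) * e.+1)).
    rewrite !big_map; apply: eq_bigr => c _.
    rewrite -bin_subnD; last by rewrite leq_mul.
    rewrite -IH; last by move: HM => /=; nia.
    by apply: eq_bigr => p _; rewrite num_up_steps_cons /weight /= subnDA.
  rewrite -big_distrr /=; case: (leqP k N) => Hk; last by rewrite bin_small.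
  rewrite addSn sum_long_steps; last by nia.
  by rewrite subSn // !mulSn; congr (_ * 'C(_, _)); lia.
under eq_bigr => p _ do rewrite num_up_steps_cons /weight /= add0n.
case: k => [|k]; first by rewrite big1 // !bin0.
under eq_bigr => p _ do rewrite eqSS.
by rewrite IH ?subSS ?binS -?mulnDl 1?addnC //; nia.
Qed.

(** * Lattice paths as ballot words *)

Lemma vertices_prefix_weights (p : lpath) :
  vertices p = [seq (weight fst (take i p), i) | i <- iota 0 (size p).+1].
Proof.
rewrite /vertices /=; congr (_ :: _); first by rewrite take0.
apply: (@eq_from_nth _ (0, 0)); rewrite ?size_scanl !size_map ?size_iota //.
move=> i Hi; rewrite nth_scanl ?size_map // (nth_map 0) ?size_iota //.
rewrite nth_iota // -map_take add1n.
have foldl_translate v q :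
    foldl translate v (map displacement q) = (v.1 + weight fst q, v.2 + size q).
  elim: q v => [|s q IH] [x y] /=; first by rewrite !addn0.
  by rewrite IH /weight /= -!addnA.
by rewrite foldl_translate size_takel.
Qed.

(* An up step in front turns weak inequalities into strict ones. *)
Lemma in_F_ballot d p :
  in_F d p = all (well_labelled d) p && ballot fst (up_step :: p).
Proof. by rewrite /in_F vertices_prefix_weights all_map ballot_cons. Qed.

(** The condition at the endpoint bounds every step, so a finite alphabet suffices. *)
Lemma in_F_step_le d p s : in_F d p -> s \in p -> s.1 <= size p.
Proof.
rewrite in_F_ballot ballot_cons => /andP[_ /allP/(_ (size p))].
rewrite mem_iota /= add0n leqnn take_size => /(_ isT) Hw Hs.
by apply: leq_trans Hw; elim: p Hs => //= t p IH; rewrite inE /weight /=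
  => /orP[/eqP->|/IH]; rewrite /weight /=; lia.
Qed.

Theorem theorem4p2 (d n k : nat) (hd : 2 <= d) :
  exists2 m : nat,
    has_card [pred p : lpath | [&& in_F d p, size p == n & num_up_steps p == k]] m
    & Nd d n k = (m%:R)%R.
Proof.
case: d hd => [|[|e]] // _.
(* [L] is the bound of [sum_words_steps] at M = N = n+1; it also exceeds every step length. *)
pose L := n.+1 + n.+1 * e; pose X := steps e L.
pose good p := in_F e.+2 p && (num_up_steps p == k).
exists (count good (words n X)).
  exists (filter good (words n X)); split.
  - by rewrite filter_uniq // words_uniq // steps_uniq.
  - move=> p; rewrite mem_filter mem_words inE /good.
    have [HF|//] := boolP (in_F _ p); have [Hn|] := eqVneq (size p) n; last first.
      by rewrite andbF.
    have -> : all (mem X) p; last by rewrite /= andbT.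
    apply/allP => s Hs; apply: mem_steps.
      by case/andP: HF => /allP/(_ s Hs).
    by apply: leq_trans (in_F_step_le _ _ _ HF Hs) _; rewrite Hn ltnW ?leq_addr.
  - by rewrite size_filter.
have count_good : count good (words n X)
    = \sum_(q <- words n.+1 X) ballot fst q * (num_up_steps q == k.+1).
  rewrite sum_wordsS big_cons [X in _ + X]big_map.
  (* A word starting with a long step violates the ballot condition at once. *)
  rewrite [X in _ + X]big1 => [|c _]; last first.
    by apply: big1 => p _; rewrite ballot_cons.
  rewrite addn0 -sum1_count big_mkcond; apply: eq_big_seq => p.
  rewrite mem_words => /andP[_ /allP Hp].
  rewrite num_up_steps_cons eqSS mulnb /good in_F_ballot.
  have -> : all (well_labelled e.+2) p; last by case: (_ && _).
  by apply/allP => s /Hp; apply: well_labelled_steps.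
have cardE : n.+1 * count good (words n X)
    = 'C(n.+1, k.+1) * 'C(n + (n - k) * (e.+2 - 2) + 1, k).
  rewrite count_good ballot_theorem => [|p q /permP E]; last first.
    by rewrite /num_up_steps E.
  (* The ballot factor n+1-t becomes ['C(n.+1 - t, 1)], the case r = 0. *)
  under eq_bigr => q _ do rewrite mulnC -[_ - _]bin1.
  rewrite sum_words_steps // subSS.
  case: (leqP k n) => Hk; last by rewrite bin_small.
  (* Complementary index: n+1+(n-k)e - k = 1+(n-k)(e+1). *)
  congr (_ * _); rewrite -[RHS]bin_sub; last by nia.
  by congr 'C(_, _); nia.
rewrite /Nd -GRing.mulrA -GRing.natrM -cardE GRing.natrM GRing.mulKf //.
by rewrite Num.Theory.pnatr_eq0.
Qed.
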